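(* Let $n\ge1$ and let $\Omega\subset\mathbb{R}^n$ be a bounded domain with smooth boundary. Let $p\ge1$ and $q\ge1$ be such that $$\frac1q+\frac{n}{2p}>1,$$ and let $T>0$ and $x_0\in\Omega$. Then there exist $L>0$, a sequence $(b_k)_{k\in\mathbb{N}}\subset C^\infty(\overline\Omega\times[0,T])$ and a positive function $V_0\in C^\infty(\overline\Omega)$ such that $$\int_0^T\|b_k(\cdot,t)\|_{L^p(\Omega)}^q\,dt\le L\qquad\text{for all }k\in\mathbb{N},$$ that $$0\le V_0\le L\ \text{ in }\Omega\qquad\text{and}\qquad\int_\Omega V_0\ge\frac1L,$$ but that for each $k\in\mathbb{N}$ there exists $V_k\in C^0(\overline\Omega\times[0,T])\cap C^{2,1}(\overline\Omega\times(0,T))$ such that $$\begin{cases} \partial_t V_k=\Delta V_k+b_k(x,t)V_k, & x\in\Omega,\ t\in(0,T),\\ \frac{\partial V_k}{\partial\nu}=0, & x\in\partial\Omega,\ t\in(0,T),\\ V_k(x,0)=V_0(x), & x\in\Omega,\end{cases}$$ and that $$\inf_{t\in(0,T)}V_k(x_0,t)\to0\qquad\text{as }k\to\infty.$$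
   Context: $\nu$ denotes the outward unit normal on $\partial\Omega$. $C^{2,1}$ refers to functions that are twice continuously differentiable in $x$ and once in $t$. *)

(* Defs.v *)
From HB Require Import structures.
From mathcomp Require Import all_boot all_order all_algebra.
From mathcomp Require Import all_classical all_reals all_analysis.
From mathcomp Require Import measurable_realfun.
Set Implicit Arguments.
Unset Strict Implicit.
Unset Printing Implicit Defensive.
Import Order.TTheory GRing.Theory Num.Theory.
Import numFieldNormedType.Exports.
Local Open Scope classical_set_scope.
Local Open Scope ring_scope.

(* A point of R^n is a row vector 'rV[R]_n, a point of R^n x R is a pair (x, t).
   The norm on 'rV[R]_n is the sup norm; it is only used for the
   topology and for boundedness, so the choice of norm does not matter there. *)

Notation borelRn R n := (g_sigma_algebraType (@open 'rV[R]_n)).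

Definition consRn (R : realType) (n : nat)
    (p : measurableTypeR R * borelRn R n) : borelRn R n.+1 :=
  row_mx (p.1%:M : 'rV[R]_1) (p.2 : 'rV[R]_n).

Lemma row_mx_ball (R : realType) (n : nat) (a b : R) (v w : 'rV[R]_n) (e : R) :
  0 < e ->
  ball (row_mx (a%:M : 'rV[R]_1) v) e (row_mx (b%:M : 'rV[R]_1) w) <->
  ball a e b /\ ball v e w.
Proof.
move=> e0; split.
  move=> [_ h]; split.
    by move: (h ord0 (@lshift 1 n ord0)); rewrite !row_mxEl !mxE !mulr1n.
  by split=> // i j; move: (h i (@rshift 1 n j)); rewrite !row_mxEr.
move=> [ab [_ vw]]; split=> // i j.
rewrite -(splitK j); case: (fintype.split j) => k /=.
  by rewrite !row_mxEl !mxE !ord1 !mulr1n.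
by rewrite !row_mxEr.
Qed.

Lemma measurable_consRn (R : realType) (n : nat) :
  measurable_fun [set: measurableTypeR R * borelRn R n] (@consRn R n).
Proof.
apply: (@measurability _ _ _ (borelRn R n.+1) _ _ (@open 'rV[R]_n.+1)) => // _ [U oU <-].
rewrite setTI.
pose e (k : nat) : R := k.+1%:R^-1.
have e0 k : 0 < e k by rewrite invr_gt0 ltr0n.
pose q2r (w : 'rV[rat]_n) : 'rV[R]_n := map_mx ratr w.
pose rect (i : rat * 'rV[rat]_n * nat) :
    set (measurableTypeR R * borelRn R n) :=
  [set p | ball (ratr i.1.1 : R) (e i.2) p.1 /\
           ball (q2r i.1.2) (e i.2) (p.2 : 'rV[R]_n)].
pose good i := forall p, rect i p -> U (consRn p).
have -> : @consRn R n @^-1` U =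
    \bigcup_i (if `[< good i >] then rect i else set0).
  apply/seteqP; split=> [[a v] /= Uav|p [i _]]; last first.
    by case: asboolP => // + ip; apply.
  have /nbhs_ballP[d /= d0 dU] : nbhs (consRn (a, v) : 'rV[R]_n.+1) U.
    exact: open_nbhs_nbhs.
  have [k kd] : exists k, e k < d / 2.
    have /cvgr0_norm_lt/(_ (d / 2)) : @harmonic R @ \oo --> 0 by exact: cvg_harmonic.
    rewrite divr_gt0 // => /(_ isT) [N _ /(_ N (leqnn N))].
    by rewrite /harmonic /= ger0_norm; [exists N | rewrite ltW // e0].
  have approx (c : R) : exists q : rat, ball (ratr q : R) (e k) c.
    have : c - e k < c + e k by rewrite ltrBlDr -addrA ltrDl addr_gt0.
    move=> /rat_in_itvoo[q]; rewrite in_itv /= => /andP[h1 h2].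
    by exists q; rewrite /ball /= ltr_distl h1 h2.
  have [q qa] := approx a.
  have [w wv] : exists w : 'rV[rat]_n, ball (q2r w) (e k) v.
    have /choice[g gP] : forall j, exists r : rat, ball (ratr r : R) (e k) (v ord0 j).
      by move=> j; exact: approx.
    exists (\row_j g j); split=> // i j; rewrite !mxE (ord1 i).
    exact: gP.
  exists (q, w, k) => //; case: asboolP => [_|]; first by [].
  case=> -[b u] [/= qb wu]; apply: dU.
  have h : ball (consRn (a, v) : 'rV[R]_n.+1) (e k + e k) (consRn (b, u)).
    apply: (@ball_triangle _ _ (row_mx ((ratr q)%:M : 'rV[R]_1) (q2r w))).
      by apply: ball_sym; apply/row_mx_ball.
    by apply/row_mx_ball.
  by apply: le_ball h; rewrite (splitr d) ltW // ltrD.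
apply: countable_bigcupT_measurable => [|[[q w] k]]; first exact: countableP.
case: asboolP => // _.
rewrite (_ : rect _ = ball (ratr q : R) (e k) `*` ball (q2r w) (e k)) //.
apply: measurableX; first by apply: open_measurable; exact: ball_open.
by apply: sub_sigma_algebra; exact: ball_open.
Qed.

Definition unconsRn (R : realType) (n : nat) (v : borelRn R n.+1) :
    measurableTypeR R * borelRn R n :=
  let w : 'rV[R]_(1 + n) := v in (lsubmx w ord0 ord0, rsubmx w).

Lemma unconsRnK (R : realType) (n : nat) :
  cancel (@unconsRn R n) (@consRn R n).
Proof.
move=> v; rewrite /unconsRn /consRn /=.
apply: etrans (@hsubmxK _ 1 1 n v); congr (row_mx _ _).
by apply/matrixP => i j; rewrite !ord1 mxE eqxx mulr1n.
Qed.

Lemma consRnK (R : realType) (n : nat) :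
  cancel (@consRn R n) (@unconsRn R n).
Proof.
by move=> [a v]; rewrite /unconsRn /consRn /= row_mxKl row_mxKr mxE eqxx mulr1n.
Qed.

Lemma measurable_unconsRn (R : realType) (n : nat) :
  measurable_fun [set: borelRn R n.+1] (@unconsRn R n).
Proof.
have openM (U : set 'rV[R]_n.+1) : open U -> measurable (U : set (borelRn R n.+1)).
  exact: sub_sigma_algebra.
apply/measurable_fun_pairP; split=> /=.
  apply: (@measurability _ _ _ _ _ _ (@RGenOpens.G R)).
    exact: RGenOpens.measurableE.
  move=> _ [_ [a [b ->]] <-]; rewrite setTI; apply: openM.
  rewrite openE => v /= vab.
  have /nbhs_ballP[d /= d0 dU] : nbhs (unconsRn v).1 `]a, b[%classic.
    by apply: open_nbhs_nbhs; split=> //; exact: interval_open.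
  apply/nbhs_ballP; exists d => // w [_ vw]; apply: dU => /=.
  by rewrite !mxE.
apply: (@measurability _ _ _ (borelRn R n) _ _ (@open 'rV[R]_n)) => //.
move=> _ [U oU <-]; rewrite setTI; apply: openM.
rewrite openE => v /= Uv.
have /nbhs_ballP[d /= d0 dU] : nbhs (unconsRn v).2 U by exact: open_nbhs_nbhs.
apply/nbhs_ballP; exists d => // w [_ vw]; apply: dU; split=> // i j /=.
by rewrite !mxE.
Qed.

Section lebesgue_cons.
Context (R : realType) (n : nat).
Variable mu : {sigma_finite_measure set (borelRn R n) -> \bar R}.

Definition lebesgue_cons : set (borelRn R n.+1) -> \bar R :=
  pushforward (@lebesgue_measure R \x mu)%E (@consRn R n).

Let lebesgue_cons0 : lebesgue_cons set0 = 0%E.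
Proof. by rewrite /lebesgue_cons /pushforward preimage_set0 measure0. Qed.

Let lebesgue_cons_ge0 A : (0 <= lebesgue_cons A)%E.
Proof. rewrite /lebesgue_cons /pushforward; exact: measure_ge0. Qed.

Let measurable_preimage (A : set (borelRn R n.+1)) :
  measurable A -> measurable (@consRn R n @^-1` A).
Proof. by move=> mA; rewrite -[X in measurable X]setTI; exact: measurable_consRn. Qed.

Let lebesgue_cons_sigma_additive : semi_sigma_additive lebesgue_cons.
Proof.
move=> F mF tF mUF; rewrite /lebesgue_cons /pushforward preimage_bigcup.
apply: measure_semi_sigma_additive => [k||].
- exact: measurable_preimage.
- apply/trivIsetP => /= i j _ _ ij; rewrite -preimage_setI.
  by move/trivIsetP : tF => /(_ _ _ _ _ ij) ->//; rewrite preimage_set0.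
- by rewrite -preimage_bigcup; exact: measurable_preimage.
Qed.

HB.instance Definition _ := isMeasure.Build _ _ _ lebesgue_cons
  lebesgue_cons0 lebesgue_cons_ge0 lebesgue_cons_sigma_additive.

Let lebesgue_cons_sigma_finite : sigma_finite setT lebesgue_cons.
Proof.
pose lam : {sigma_finite_measure set (measurableTypeR R) -> \bar R} :=
  @lebesgue_measure R.
have /sigma_finiteP[F [TF ndF Foo]] := sigma_finiteT lam.
have /sigma_finiteP[G [TG ndG Goo]] := sigma_finiteT mu.
exists (fun k => @unconsRn R n @^-1` (F k `*` G k)) => [|k].
  apply/esym; rewrite -subTset => v _.
  have [k _ Fk] : (\bigcup_k F k) (unconsRn v).1 by rewrite -TF.
  have [l _ Gl] : (\bigcup_k G k) (unconsRn v).2 by rewrite -TG.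
  exists (maxn k l) => //; split => /=.
    by move: Fk; apply/subsetPset/ndF/leq_maxl.
  by move: Gl; apply/subsetPset/ndG/leq_maxr.
have [mF Fk] := Foo k; have [mG Gk] := Goo k; split.
  rewrite -[X in measurable X]setTI; apply: measurable_unconsRn => //.
  exact: measurableX.
rewrite /lebesgue_cons /pushforward -comp_preimage.
rewrite (_ : _ \o _ = id) ?preimage_id; last first.
  by apply/funext => p; exact: consRnK.
by rewrite product_measure1E // lte_mul_pinfty // ge0_fin_numE.
Qed.

HB.instance Definition _ := Measure_isSigmaFinite.Build _ _ _ lebesgue_cons
  lebesgue_cons_sigma_finite.

End lebesgue_cons.

(* Under the identification R^(n+1) = R x R^n, Lebesgue measure on R^(n+1) is
   the product of the one on R and the one on R^n; R^0 is a point of mass 1. *)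
Fixpoint lebesgueRn (R : realType) (n : nat) :
    {sigma_finite_measure set (borelRn R n) -> \bar R} :=
  match n with
  | 0%N => [the {sigma_finite_measure set (borelRn R 0) -> \bar R} of
             @dirac _ (borelRn R 0) (0 : 'rV[R]_0) R]
  | n'.+1 => [the {sigma_finite_measure set (borelRn R n'.+1) -> \bar R} of
             lebesgue_cons (lebesgueRn R n')]
  end.

Lemma measurable_box (R : realType) (n : nat) (a b : 'I_n -> R) :
  measurable ([set x : 'rV[R]_n | forall i, a i <= x ord0 i <= b i]
              : set (borelRn R n)).
Proof.
rewrite -[X in measurable X]setCK; apply: measurableC.
apply: sub_sigma_algebra; apply: closed_openC.
rewrite (_ : mkset _ = \bigcap_(i in [set: 'I_n])
    ((fun x : 'rV[R]_n => x ord0 i) @^-1` `[a i, b i]%classic)).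
  apply: closed_bigI => i _; apply: preimage_closed => [x _|].
    exact: coord_continuous.
  exact: interval_closed.
apply/seteqP; split=> x /= h i; first by move=> _; rewrite /= in_itv; exact: h.
by have := h i Logic.I; rewrite /= in_itv.
Qed.

Lemma consRn0 (R : realType) (n : nat) (p : measurableTypeR R * borelRn R n) :
  (consRn p : 'rV[R]_n.+1) ord0 ord0 = p.1.
Proof.
rewrite (_ : @ord0 n = @lshift 1 n ord0); last exact: val_inj.
by apply: etrans (row_mxEl _ _ _ _) _; rewrite mxE eqxx mulr1n.
Qed.

Lemma consRnS (R : realType) (n : nat) (p : measurableTypeR R * borelRn R n)
    (i : 'I_n) :
  (consRn p : 'rV[R]_n.+1) ord0 (lift ord0 i) = (p.2 : 'rV[R]_n) ord0 i.
Proof.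
rewrite (_ : lift ord0 i = @rshift 1 n i); last exact: val_inj.
exact: row_mxEr.
Qed.

Lemma lebesgueRn_box (R : realType) (n : nat) (a b : 'I_n -> R) :
  (forall i, a i <= b i) ->
  lebesgueRn R n [set x : 'rV[R]_n | forall i, a i <= x ord0 i <= b i] =
  (\prod_(i < n) (b i - a i))%:E.
Proof.
elim: n a b => [|n IH] a b ab /=.
  by rewrite big_ord0 diracE mem_set //= => -[].
rewrite /lebesgue_cons /pushforward.
pose B := [set x : 'rV[R]_n |
  forall i, a (lift ord0 i) <= x ord0 i <= b (lift ord0 i)].
rewrite (_ : _ @^-1` _ = `[a ord0, b ord0]%classic `*` B); last first.
  apply/seteqP; split=> -[t v] /=.
    move=> h; split=> [|i] /=.
      by have := h ord0; rewrite consRn0 in_itv.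
    by have := h (lift ord0 i); rewrite consRnS.
  rewrite in_itv /= => -[ht hv] i.
  by case: (unliftP ord0 i) => [k|] ->; rewrite ?consRnS ?consRn0.
rewrite product_measure1E //; last exact: measurable_box.
rewrite IH // big_ord_recl EFinM; congr (_ * _)%E.
apply: etrans (lebesgue_measure_itv _) _ => /=.
rewrite lte_fin; case: ltP => // ba.
have -> : b ord0 = a ord0 by apply/eqP; rewrite eq_le ba ab.
by rewrite (subrr (a ord0)).
Qed.

Definition Lp_norm (R : realType) (n : nat) (O : set 'rV[R]_n) (p : R)
    (f : 'rV[R]_n -> R) : \bar R :=
  'N[lebesgueRn R n]_p%:E [EFin \o (f \_ O)].

Definition basis_vec (R : realType) (n : nat) (i : 'I_n) : 'rV[R]_n :=
  delta_mx ord0 i.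

Definition space_dir (R : realType) (n : nat) (i : 'I_n) : 'rV[R]_n * R :=
  (basis_vec R i, 0).
Definition time_dir (R : realType) (n : nat) (_ : unit) : 'rV[R]_n * R :=
  (0, 1).
Definition spacetime_dir (R : realType) (n : nat) (i : option 'I_n) :
    'rV[R]_n * R :=
  if i is Some j then space_dir R j else time_dir R n tt.

(* [Ck dir D K k f]: with D open and D `<=` K `<=` closure D, all the iterated
   derivatives of f of order at most k in the directions [dir i] exist in D and
   extend continuously to K (f itself being continuous on K). Values outside K
   are irrelevant. *)
Fixpoint Ck (R : realType) (E : normedModType R) (I : Type) (dir : I -> E)
    (D K : set E) (k : nat) (f : E -> R) : Prop :=
  {within K, continuous f} /\
  match k with
  | 0%N => True
  | k'.+1 => forall i, exists2 g : E -> R,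
      (forall x, D x -> is_derive x (dir i) f (g x)) & Ck dir D K k' g
  end.

Definition Cinf (R : realType) (E : normedModType R) (I : Type) (dir : I -> E)
    (D K : set E) (f : E -> R) : Prop :=
  forall k, Ck dir D K k f.

Definition C21 (R : realType) (n : nat) (D K : set ('rV[R]_n * R))
    (f : 'rV[R]_n * R -> R) : Prop :=
  Ck (@space_dir R n) D K 2 f /\ Ck (@time_dir R n) D K 1 f.

Definition laplacian (R : realType) (n : nat) (f : 'rV[R]_n -> R)
    (x : 'rV[R]_n) : R :=
  \sum_(i < n) 'D_(basis_vec R i) ('D_(basis_vec R i) f) x.

Definition gradient (R : realType) (n : nat) (f : 'rV[R]_n -> R)
    (x : 'rV[R]_n) : 'rV[R]_n :=
  \row_i 'D_(basis_vec R i) f x.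

Definition euclidean_norm (R : realType) (n : nat) (v : 'rV[R]_n) : R :=
  Num.sqrt (\sum_(i < n) v ord0 i ^+ 2).

Definition boundary (R : realType) (n : nat) (O : set 'rV[R]_n) :
    set 'rV[R]_n :=
  closure O `\` interior O.

(* Near x, O is the sublevel set {phi < 0} of a smooth phi without critical
   point at x; hence O lies locally on one side of a smooth hypersurface, with
   outward normal the normalised gradient of phi. *)
Definition local_defining_function (R : realType) (n : nat)
    (O : set 'rV[R]_n) (x : 'rV[R]_n) (phi : 'rV[R]_n -> R) : Prop :=
  exists U : set 'rV[R]_n,
    [/\ open U, U x, Cinf (@basis_vec R n) U U phi,
        (forall y, U y -> (O y <-> phi y < 0)) & gradient phi x != 0].

Definition smooth_bounded_domain (R : realType) (n : nat)
    (O : set 'rV[R]_n) : Prop :=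
  [/\ open O, connected O, bounded_set O &
      forall x, boundary O x -> exists phi, local_defining_function O x phi].

Definition outward_unit_normal (R : realType) (n : nat) (O : set 'rV[R]_n)
    (x nu : 'rV[R]_n) : Prop :=
  exists2 phi, local_defining_function O x phi &
    nu = (euclidean_norm (gradient phi x))^-1 *: gradient phi x.

(* For f differentiable up to the boundary this is the derivative of f at x in
   the direction nu; it is computed from inside the domain, f being only
   meaningful there. *)
Definition normal_derivative_is (R : realType) (n : nat) (f : 'rV[R]_n -> R)
    (x nu : 'rV[R]_n) (l : R) : Prop :=
  (f x - f (x - h *: nu)) / h @[h --> 0^'+] --> l.

(* Main.v *)
Require Import Defs.
From mathcomp Require Import all_boot all_order all_algebra.
From mathcomp Require Import all_classical all_reals all_analysis.
From mathcomp Require Import ring lra.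
Import Order.TTheory GRing.Theory Num.Theory.
Import numFieldNormedType.Exports.
Local Open Scope classical_set_scope.
Local Open Scope ring_scope.

(** The solutions are prescribed and the potentials computed from them. Any
    positive smooth V solves V_t = Laplacian V + b V for
    b = W_t - Laplacian W - |grad W|^2, where W = ln V. Take V_0 = 1 and let V_k be
    1 except for a well of depth parameter k, supported in a parabolic cylinder of
    radius delta around (x0, T/2) that stays away from the boundary of Omega and
    from t = 0: then V_k is constant near the boundary, so its normal
    derivative vanishes there, and V_k(x0, T/2) = exp(- c k) tends to 0.

    On the cylinder |b_k| is at most C_k delta^-2, so the integral over time of the
    q-th power of the L^p norm is at most a constant depending on k times
    delta^(-2q + nq/p + 2). The exponent is positive exactly when
    1/q + n/(2p) > 1, and then delta, chosen after k, makes this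
    integral at most 1 however fast C_k grows ([mixed_norm_well_potential],
    [exists_small_scale]).

    The well is exp(- k f(u)), where f(s) = exp(-1/s) for s > 0 and f(s) = 0
    otherwise, and u = 1 - |x - x0|^2 / delta^2 - (t - T/2)^2 / delta^4.
    Since the derivatives of f are combinations of s^-m exp(-1/s), which are
    bounded by m!, all bounds are explicit ([is_derive_flat], [flat_le_fact]). *)

(** * Derivatives along a direction *)

(** A derivative along [v] is an ordinary derivative on the line through [x];
    this reduces the chain rule and the restriction to slices to functions of
    one real variable, without asking [f] to be differentiable at [x]. *)
Lemma is_derive_line (R : realType) (E : normedModType R) (f : E -> R)
    (x v : E) (a : R) :
  is_derive x v f a <-> is_derive (0 : R) 1 (fun h : R => f (h *: v + x)) a.
Proof.
have dE : (fun h : R => h^-1 *: ((f \o shift x) (h *: v) - f x)) =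
  (fun h : R => h^-1 *:
    (((fun h : R => f (h *: v + x)) \o shift (0 : R)) (h *: (1 : R)) -
     (fun h : R => f (h *: v + x)) 0)).
  by apply/funext => h /=; rewrite /shift /= addr0 scale0r add0r [h *: 1]mulr1.
have E1 : derivable f x v = derivable (fun h : R => f (h *: v + x)) 0 1.
  by rewrite /derivable dE.
have E2 : 'D_v f x = 'D_1 (fun h : R => f (h *: v + x)) 0.
  by rewrite /derive dE.
by split=> -[h1 h2]; apply: DeriveDef; rewrite ?E1 ?E2 // -?E1 -?E2.
Qed.

Lemma is_derive_comp_dir {R : realType} {E : normedModType R} {phi : R -> R}
    {f : E -> R} {x v : E} {a b : R} :
  is_derive (f x) 1 phi b -> is_derive x v f a ->
  is_derive x v (fun y => phi (f y)) (b * a).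
Proof.
move=> dphi /is_derive_line df; apply/is_derive_line.
apply: (@is_derive1_comp _ phi (fun h : R => f (h *: v + x))) => //.
by rewrite scale0r add0r.
Qed.

(** * Algebra of functions with continuous iterated derivatives *)

Lemma Ck_continuous {R : realType} {E : normedModType R} {I : Type}
    {dir : I -> E} {D K : set E} {k : nat} {f : E -> R} :
  Ck dir D K k f -> {within K, continuous f}.
Proof. by case: k => [|k] []. Qed.

Section smooth_algebra.
Context (R : realType) (E : normedModType R) (I : Type) (dir : I -> E).
Implicit Types (D K : set E) (f g : E -> R).

Lemma CkW D K k f : Ck dir D K k.+1 f -> Ck dir D K k f.
Proof.
elim: k f => [|k IH] f [cf df]; first by [].
split=> // i; have [g dg Cg] := df i.
by exists g => //; exact: IH.
Qed.

Lemma Ck_sub D D' K K' k f : D' `<=` D -> K' `<=` K ->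
  Ck dir D K k f -> Ck dir D' K' k f.
Proof.
move=> DD KK; elim: k f => [|k IH] f [cf df];
    (split; first exact: continuous_subspaceW cf) => //.
move=> i; have [g dg Cg] := df i; exists g => [x /DD|]; [exact: dg|exact: IH].
Qed.

Lemma Ck_cst D K k (c : R) : Ck dir D K k (fun=> c).
Proof.
elim: k c => [|k IH] c;
    (split; first by
      apply: continuous_subspaceT => x; exact: cst_continuous) => //.
move=> i; exists (fun=> 0) => // x _.
exact: is_derive_cst.
Qed.

Lemma CkD D K k f g : Ck dir D K k f -> Ck dir D K k g ->
  Ck dir D K k (fun x => f x + g x).
Proof.
elim: k f g => [|k IH] f g [cf df] [cg dg];
    (split; first by move=> x; apply: continuousD; [exact: cf|exact: cg]) => //.
move=> i; have [f' df' Cf'] := df i; have [g' dg' Cg'] := dg i.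
exists (fun x => f' x + g' x); last exact: IH.
by move=> x Dx; apply: is_deriveD; [exact: df'|exact: dg'].
Qed.

Lemma CkM D K k f g : Ck dir D K k f -> Ck dir D K k g ->
  Ck dir D K k (fun x => f x * g x).
Proof.
elim: k f g => [|k IH] f g Cf Cg;
    (split; first by
      move=> x; apply: continuousM; apply: Ck_continuous; eassumption) => //.
move=> i; have [_ /(_ i)[f' df' Cf']] := Cf; have [_ /(_ i)[g' dg' Cg']] := Cg.
exists (fun x => f x * g' x + g x * f' x).
  by move=> x Dx; apply: is_deriveM; [exact: df'|exact: dg'].
by apply: CkD; apply: IH => //; exact: CkW.
Qed.

(** The chain rule turns the derivative of [phi \o f] into a product whose
    factors have one derivative less, so the induction on the order uses the
    closure under products. *)
Lemma Ck_comp D K k (phi : R -> R) f :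
  Ck (fun _ : unit => 1 : R) setT setT k phi -> Ck dir D K k f ->
  Ck dir D K k (fun x => phi (f x)).
Proof.
elim: k phi f => [|k IH] phi f Cphi Cf.
all: have cphi : continuous phi
  by apply/continuous_subspace_setT => x; exact: (Ck_continuous Cphi).
all: split; first by
  move=> x; apply: (continuous_comp (Ck_continuous Cf x)); exact: cphi.
by [].
move=> i; have [_ /(_ tt)[phi' dphi Cphi']] := Cphi.
have [_ /(_ i)[f' df Cf']] := Cf.
exists (fun x => phi' (f x) * f' x).
  by move=> x Dx; apply: is_derive_comp_dir; [exact: dphi|exact: df].
apply: CkM => //; apply: IH => //; exact: CkW.
Qed.

Lemma CkN D K k f : Ck dir D K k f -> Ck dir D K k (fun x => - f x).
Proof.
rewrite (_ : (fun x => - f x) = fun x => -1 * f x); last first.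
  by apply/funext => x; rewrite mulN1r.
by apply: CkM; exact: Ck_cst.
Qed.

Lemma Ck_affine D K k f (c : I -> R) : continuous f ->
  (forall x i, is_derive x (dir i) f (c i)) -> Ck dir D K k f.
Proof.
move=> cf df; case: k => [|k]; split=> //; try exact: continuous_subspaceT.
by move=> i; exists (fun=> c i); [move=> x _; exact: df|exact: Ck_cst].
Qed.

Lemma Ck_sum D K k (J : Type) (r : seq J) (F : J -> E -> R) :
  (forall j, Ck dir D K k (F j)) -> Ck dir D K k (fun x => \sum_(j <- r) F j x).
Proof.
move=> CF; elim: r => [|j r IH].
  rewrite (_ : (fun _ => _) = fun=> 0); first exact: Ck_cst.
  by apply/funext => x; rewrite big_nil.
rewrite (_ : (fun _ => _) = fun x => F j x + \sum_(j <- r) F j x).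
  exact: CkD.
by apply/funext => x; rewrite big_cons.
Qed.

End smooth_algebra.

(** * A smooth function vanishing on the negative half-line *)

(** The functions x^-m exp(-1/x), extended by 0: they span a space that contains
    exp(-1/x) and is stable under differentiation, which makes smoothness a
    plain induction. *)
Definition flat {R : realType} (m : nat) (x : R) : R :=
  if 0 < x then x^-1 ^+ m * expR (- x^-1) else 0.

Section flat.
Context {R : realType}.

Lemma flat_ge0 m (x : R) : 0 <= flat m x.
Proof.
rewrite /flat; case: ifP => // x0.
by rewrite mulr_ge0 ?expR_ge0// exprn_ge0// invr_ge0 ltW.
Qed.

Lemma flat_le0 m (x : R) : x <= 0 -> flat m x = 0.
Proof. by rewrite /flat ltNge => ->. Qed.

(** With y = 1/x, this is y^m / m! <= exp y. *)
Lemma flat_le_fact m (x : R) : flat m x <= m`!%:R.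
Proof.
rewrite /flat; case: ifP => // x0.
have y0 : 0 < x^-1 by rewrite invr_gt0.
rewrite expRN ler_pdivrMr ?expR_gt0//.
case: m => [|m].
  by rewrite expr0 fact0 mul1r ltW// expR_gt1.
rewrite -ler_pdivrMl ?ltr0n ?fact_gt0// mulrC.
by apply: (le_trans _ (@expR_ge1Dxn _ _ m (ltW y0))); lra.
Qed.

Lemma flatS m (x : R) : flat m x = x * flat m.+1 x.
Proof.
rewrite /flat; case: ifP => x0; last by rewrite mulr0.
by rewrite exprS !mulrA mulfV ?gt_eqF// mul1r.
Qed.

Lemma norm_flat_le m (x : R) : `|flat m x| <= m.+1`!%:R * `|x|.
Proof.
rewrite flatS normrM mulrC ler_wpM2r// ger0_norm ?flat_ge0//.
exact: flat_le_fact.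
Qed.

(** At 0 the difference quotient of [flat m] is [flat m.+1], which tends to 0
    because it is at most a multiple of the identity. *)
Lemma is_derive_flat m (x : R) :
  is_derive x 1 (flat m) (flat m.+2 x - m%:R * flat m.+1 x).
Proof.
case: (ltgtP x 0) => x0.
- rewrite !flat_le0 ?ltW// mulr0 subr0.
  apply: (@near_eq_is_derive _ _ _ (cst 0)).
  near=> y; rewrite flat_le0//.
  by apply: ltW; near: y; exact: lt_nbhsl.
- apply: (@near_eq_is_derive _ _ _ (fun y : R => y^-1 ^+ m * expR (- y^-1))).
    near=> y; rewrite /flat ifT//.
    by near: y; exact: lt_nbhsr.
  have dV : is_derive x 1 (fun y : R => y^-1) (- x ^- 2).
    have := @is_deriveV _ id x 1 1 (lt0r_neq0 x0) _.
    move=> /(_ _)/is_derive_eq; apply.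
    by rewrite ?scaler1// /GRing.scale /= mulr1.
  have dE := @is_derive1_comp _ expR (fun y => - y^-1) x _ _
    (is_derive_expR _) (is_deriveN dV).
  have -> : (fun y : R => y^-1 ^+ m * expR (- y^-1)) =
      (fun y : R => y^-1) ^+ m * (expR \o (fun y => - y^-1)).
    by apply/funext => y; rewrite !fctE.
  apply: is_derive_eq (is_deriveM (is_deriveX m dV) dE) _.
  rewrite /flat x0 /= !fctE /GRing.scale /= -exprVn !exprS.
  by case: m => [|m] /=; rewrite ?exprS; ring.
- subst x; rewrite !flat_le0// mulr0 subr0.
  apply/is_derive1_caratheodory; exists (flat m.+1); split.
  + by move=> z; rewrite (flat_le0 m 0 (lexx 0)) !subr0 mulrC -flatS.
  + rewrite /prop_for /continuous_at (flat_le0 m.+1 0 (lexx 0)).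
    apply/cvgr0Pnorm_le => /= e e0; near=> y.
    apply: le_trans (norm_flat_le _ _) _.
    rewrite -ler_pdivlMl ?ltr0n ?fact_gt0//.
    near: y; apply: cvgr0_norm_le => //.
    by rewrite mulr_gt0 ?invr_gt0 ?ltr0n ?fact_gt0.
  + by rewrite flat_le0.
Unshelve. all: by end_near.
Qed.

Lemma Cinf_flat m : Cinf (fun _ : unit => 1 : R) setT setT (flat m).
Proof.
move=> k; elim: k m => [|k IH] m.
all: have cflat : {within setT, continuous (flat m : R -> R)}.
1,3: apply: continuous_subspaceT => x;
  have [dx _] := is_derive_flat m x;
  exact/differentiable_continuous/derivable1_diffP.
by [].
split=> // i; exists (fun x => flat m.+2 x + (- m%:R) * flat m.+1 x).
  by move=> x _; apply: is_derive_eq (is_derive_flat m x) _; rewrite mulNr.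
by apply: CkD => //; apply: CkM => //; exact: Ck_cst.
Qed.

Lemma Cinf_expR : Cinf (fun _ : unit => 1 : R) setT setT (@expR R).
Proof.
elim=> [|k IH];
    (split; first by
      apply: continuous_subspaceT; exact: continuous_expR) => //.
by move=> i; exists expR => // x _; exact: is_derive_expR.
Qed.

End flat.

(** * Integral bounds for functions that need not be measurable *)

Section integral_bounds.
Context (d : measure_display) (T : measurableType d) (R : realType).
Variable mu : {measure set T -> \bar R}.
Local Open Scope ereal_scope.
Import HBNNSimple.

(** The integral of a nonnegative function is a supremum over the simple functions
    below it, hence monotone without any measurability; this spares a proof that
    the spatial norm is measurable in time. *)
Lemma ge0_le_integral_restrict (D A : set T) (f g : T -> \bar R) :
  (forall x, D x -> 0 <= f x) -> (forall x, A x -> 0 <= g x) ->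
  (forall x, (f \_ D) x <= (g \_ A) x) ->
  \int[mu]_(x in D) f x <= \int[mu]_(x in A) g x.
Proof.
move=> f0 g0 fg; rewrite !ge0_integralE//.
apply: le_ereal_sup => _ [h hf <-]; exists h => // x.
exact: le_trans (hf x) (fg x).
Qed.

Lemma integral_le_cst_on (D A : set T) (f : T -> \bar R) (c : R) :
  measurable A -> (0 <= c)%R -> (forall x, D x -> 0 <= f x) ->
  (forall x, D x -> A x -> f x <= c%:E) ->
  (forall x, D x -> ~ A x -> f x = 0) ->
  \int[mu]_(x in D) f x <= c%:E * mu A.
Proof.
move=> mA c0 f0 fc fA; rewrite -integral_cst//.
apply: ge0_le_integral_restrict => // x; rewrite !patchE.
case: ifPn => [/set_mem Dx|_]; last by case: ifP.
case: ifPn => [/set_mem Ax|/negP Ax]; first exact: fc.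
by rewrite fA// => /mem_set.
Qed.

Lemma measure_le_integral_cst1 (D A : set T) :
  measurable A -> A `<=` D -> mu A <= \int[mu]_(x in D) 1.
Proof.
move=> mA AD; rewrite -[mu A]mul1e -integral_cst//.
apply: ge0_le_integral_restrict => // x; rewrite !patchE.
by case: ifPn => [/set_mem /AD/mem_set ->//|_]; case: ifP.
Qed.

End integral_bounds.

Section Lp.
Context (R : realType) (n : nat).
Implicit Types (O A : set 'rV[R]_n).

Lemma Lp_norm0 O (p : R) : p != 0 -> Lp_norm O p (fun=> 0) = 0%E.
Proof.
move=> p0; rewrite /Lp_norm -(@Lnorm0 _ _ _ (lebesgueRn R n) p%:E)//.
by apply: eq_Lnorm => x /=; rewrite patchE; case: ifP.
Qed.

Lemma Lp_norm_le_cst_on O A (p c m : R) (f : 'rV[R]_n -> R) :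
  0 < p -> 0 <= c -> 0 <= m ->
  measurable (A : set (borelRn R n)) -> lebesgueRn R n A = m%:E ->
  (forall x, A x -> `|f x| <= c) -> (forall x, ~ A x -> f x = 0) ->
  (Lp_norm O p f <= (c * m `^ p^-1)%:E)%E.
Proof.
move=> p0 c0 m0 mA Am fc fA.
have p0' := lt0r_neq0 p0.
rewrite /Lp_norm unlock /Lnorm.
have -> : (c * m `^ p^-1)%:E = ((c `^ p * m)%:E `^ p^-1)%E.
  rewrite poweR_EFin powRM// ?powR_ge0//.
  by rewrite -powRrM mulfV// powRr1.
apply: gt0_ler_poweR.
- by rewrite invr_ge0 ltW.
- by rewrite in_itv /= integral_ge0 ?leey// => x _; exact: poweR_ge0.
- by rewrite in_itv /= leey lee_fin mulr_ge0 ?powR_ge0.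
rewrite EFinM -Am; apply: integral_le_cst_on => //.
- exact: powR_ge0.
- by move=> x _; exact: poweR_ge0.
- move=> x _ Ax.
  have -> : ((`|(EFin \o (f \_ O)) x| `^ p) =
             (`|(f \_ O) x| `^ p)%:E)%E by [].
  rewrite lee_fin; apply: ge0_ler_powR; rewrite ?nnegrE ?(ltW p0)//.
  rewrite patchE; case: ifP => _; [exact: fc|by rewrite normr0].
- move=> x _ Ax.
  have -> : ((`|(EFin \o (f \_ O)) x| `^ p) =
             (`|(f \_ O) x| `^ p)%:E)%E by [].
  by rewrite patchE fA// if_same normr0 powR0.
Qed.
End Lp.

(** * Mixed norms of functions supported in a small box *)

Definition cube {R : realType} {n : nat} (x0 : 'rV[R]_n) (r : R) :
    set 'rV[R]_n :=
  [set x | forall i, x0 ord0 i - r <= x ord0 i <= x0 ord0 i + r].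

Section cube.
Context (R : realType) (n : nat).

Lemma measurable_cube (x0 : 'rV[R]_n) (r : R) :
  measurable (cube x0 r : set (borelRn R n)).
Proof.
exact: (measurable_box (fun i => x0 ord0 i - r) (fun i => x0 ord0 i + r)).
Qed.

Lemma lebesgueRn_cube (x0 : 'rV[R]_n) (r : R) : 0 <= r ->
  lebesgueRn R n (cube x0 r) = ((2 * r) ^+ n)%:E.
Proof.
move=> r0; rewrite /cube (lebesgueRn_box (a := fun i => x0 ord0 i - r)
  (b := fun i => x0 ord0 i + r)).
  rewrite -[n in RHS]card_ord -prodr_const; congr (_%:E).
  apply: eq_bigr => i _.
  by ring.
by move=> i; lra.
Qed.

Lemma mixed_norm_le_cst_on_box (O : set 'rV[R]_n) (p q c r s T t0 : R)
    (x0 : 'rV[R]_n)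
    (f : 'rV[R]_n * R -> R) :
  0 < p -> 0 < q -> 0 <= c -> 0 <= r -> 0 <= s ->
  (forall x t, `|f (x, t)| <= c) ->
  (forall x t, f (x, t) != 0 -> cube x0 r x /\ `|t - t0| <= s) ->
  (\int[lebesgue_measure]_(t in `]0%R, T[)
     (Lp_norm O p (fun x => f (x, t)) `^ q)
   <= ((c * ((2 * r) ^+ n) `^ p^-1) `^ q * (2 * s))%:E)%E.
Proof.
move=> p0 q0 c0 r0 s0 fc fs.
have m0 : 0 <= (2 * r) ^+ n by rewrite exprn_ge0// mulr_ge0.
have mu_I : lebesgue_measure `[t0 - s, t0 + s]%classic = (2 * s)%:E.
  rewrite lebesgue_measure_itv /= lte_fin.
  by case: ltP => h; congr (_%:E); lra.
rewrite EFinM -mu_I; apply: integral_le_cst_on => //.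
- exact: powR_ge0.
- by move=> t _; exact: poweR_ge0.
- move=> t _ _; rewrite -poweR_EFin; apply: gt0_ler_poweR.
  + exact: ltW.
  + by rewrite in_itv /= Lnorm_ge0 leey.
  + by rewrite in_itv /= leey lee_fin mulr_ge0// powR_ge0.
  + apply: (@Lp_norm_le_cst_on _ _ _ (cube x0 r)) => //.
    * exact: measurable_cube.
    * exact: lebesgueRn_cube.
    * move=> x nx; apply/eqP/negP => /negP f0; apply: nx.
      by case: (fs x t f0).
- move=> t _ nt; rewrite (_ : (fun x => f (x, t)) = fun=> 0).
    by rewrite Lp_norm0 ?lt0r_neq0// poweR0r// lt0r_neq0.
  apply/funext => x; apply/eqP/negP => /negP /fs[_ ts]; apply: nt.
  by rewrite /= in_itv /=; move: ts; rewrite ler_norml; lra.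
Qed.

End cube.

(** * Derivatives in space and in time *)

Lemma is_derive_sum_fun {R : realType} {E : normedModType R} {n : nat}
    {f : 'I_n -> E -> R} {x v : E} {df : 'I_n -> R} :
  (forall i, is_derive x v (f i) (df i)) ->
  is_derive x v (fun y => \sum_(i < n) f i y) (\sum_(i < n) df i).
Proof.
move=> h; rewrite (_ : (fun y => _) = \sum_(i < n) f i); first exact: is_derive_sum.
by apply/funext => y; rewrite fct_sumE.
Qed.

Section spacetime.
Context {R : realType} {n : nat}.
Implicit Types (z v : 'rV[R]_n * R) (f : 'rV[R]_n * R -> R).

Lemma is_derive_space_coord z v (i : 'I_n) :
  is_derive z v (fun y : 'rV[R]_n * R => y.1 ord0 i) (v.1 ord0 i).
Proof.
apply/is_derive_line => /=.
rewrite (_ : (fun h : R => _) =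
  (fun h : R => v.1 ord0 i *: h) + cst (z.1 ord0 i)); last first.
  by apply/funext => h; rewrite !mxE; congr (_ + _); exact: mulrC.
apply: is_derive_eq
  (is_deriveD (is_deriveZ _ (is_derive_id _ _)) (is_derive_cst _ _ _)) _.
by rewrite addr0 [LHS]mulr1.
Qed.

Lemma is_derive_time_coord z v :
  is_derive z v (fun y : 'rV[R]_n * R => y.2) v.2.
Proof.
apply/is_derive_line => /=.
rewrite (_ : (fun h : R => _) = (fun h : R => v.2 *: h) + cst z.2); last first.
  by apply/funext => h; congr (_ + _); exact: mulrC.
apply: is_derive_eq
  (is_deriveD (is_deriveZ _ (is_derive_id _ _)) (is_derive_cst _ _ _)) _.
by rewrite addr0 [LHS]mulr1.
Qed.

Lemma Ck_space_coord (I : Type) (dir : I -> 'rV[R]_n * R) D K k (i : 'I_n) :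
  Ck dir D K k (fun y : 'rV[R]_n * R => y.1 ord0 i).
Proof.
apply: (@Ck_affine _ _ _ _ _ _ _ _ (fun j => (dir j).1 ord0 i)).
  move=> z; apply: (@continuous_comp _ _ _ fst (fun y : 'rV[R]_n => y ord0 i)).
    exact: cvg_fst.
  exact: coord_continuous.
by move=> z j; exact: is_derive_space_coord.
Qed.

Lemma Ck_time_coord (I : Type) (dir : I -> 'rV[R]_n * R) D K k :
  Ck dir D K k (fun y : 'rV[R]_n * R => y.2).
Proof.
apply: (@Ck_affine _ _ _ _ _ _ _ _ (fun j => (dir j).2)).
  by move=> z; exact: cvg_snd.
by move=> z j; exact: is_derive_time_coord.
Qed.

Lemma is_derive_space_slice f (x : 'rV[R]_n) (t : R) (i : 'I_n) (a : R) :
  is_derive (x, t) (space_dir R i) f a ->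
  is_derive x (basis_vec R i) (fun y => f (y, t)) a.
Proof.
move=> /is_derive_line df; apply/is_derive_line.
rewrite (_ : (fun h : R => _) = fun h : R => f (h *: space_dir R i + (x, t)))//.
apply/funext => h; congr (f (_, _)).
by rewrite /= scaler0 add0r.
Qed.

Lemma is_derive_time_slice f (x : 'rV[R]_n) (t : R) (a : R) :
  is_derive (x, t) (time_dir R n tt) f a ->
  is_derive t 1 (fun s => f (x, s)) a.
Proof.
move=> /is_derive_line df; apply/is_derive_line.
rewrite (_ : (fun h : R => _) = fun h : R => f (h *: time_dir R n tt + (x, t)))//.
apply/funext => h; congr (f (_, _)).
by rewrite /= scaler0 add0r.
Qed.

End spacetime.

(** * The heat equation solved by an exponential well *)

Section profile.
Context (R : realType) (n : nat).
Variables (x0 : 'rV[R]_n) (t0 delta M : R).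
Implicit Types (z v : 'rV[R]_n * R).

Definition rescaled_space (i : 'I_n) z : R :=
  delta^-1 * (z.1 ord0 i - x0 ord0 i).
Definition rescaled_time z : R := delta^-1 ^+ 2 * (z.2 - t0).
Definition paraboloid z : R :=
  1 - \sum_(i < n) rescaled_space i z ^+ 2 - rescaled_time z ^+ 2.

(** Equal to 1 outside the parabolic cylinder of radius [delta] around
    [(x0, t0)], of depth growing with [M], and positive: being an exponential, it
    can be divided by, and its logarithmic derivatives are smooth. *)
Definition well z : R := expR (- M * flat 0 (paraboloid z)).

(** [log_slope] and [log_curvature] are the first two derivatives of
    s |-> - M * flat 0 s, the logarithm of the profile, taken at s = [paraboloid z]. *)
Definition log_slope z : R := - M * flat 2 (paraboloid z).
Definition log_curvature z : R :=
  - M * (flat 4 (paraboloid z) - 2 * flat 3 (paraboloid z)).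

(** For W = ln [well], this is W_t - Laplacian W - |grad W|^2, which is what the
    equation V_t = Laplacian V + b V prescribes for b when V = exp W. *)
Definition well_potential z : R :=
  delta^-1 ^+ 2 * (2 * log_slope z * (n%:R - rescaled_time z)
    - 4 * (log_curvature z + log_slope z ^+ 2) *
        \sum_(i < n) rescaled_space i z ^+ 2).

Lemma is_derive_rescaled_space i z v :
  is_derive z v (rescaled_space i) (delta^-1 * v.1 ord0 i).
Proof.
have h : is_derive z v (rescaled_space i) _ :=
  is_deriveZ delta^-1 (is_deriveB (is_derive_space_coord z v i)
    (is_derive_cst (x0 ord0 i) z v)).
by apply: is_derive_eq h _; rewrite subr0.
Qed.

Lemma is_derive_rescaled_time z v :
  is_derive z v rescaled_time (delta^-1 ^+ 2 * v.2).
Proof.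
have h : is_derive z v rescaled_time _ :=
  is_deriveZ (delta^-1 ^+ 2) (is_deriveB (is_derive_time_coord z v)
    (is_derive_cst t0 z v)).
by apply: is_derive_eq h _; rewrite subr0.
Qed.

Lemma is_derive_paraboloid z v :
  is_derive z v paraboloid
    (- (\sum_(i < n) 2 * rescaled_space i z * (delta^-1 * v.1 ord0 i))
     - 2 * rescaled_time z * (delta^-1 ^+ 2 * v.2)).
Proof.
have dsq i : is_derive z v (fun y => rescaled_space i y ^+ 2)
    (2 * rescaled_space i z * (delta^-1 * v.1 ord0 i)).
  have h : is_derive z v (fun y => rescaled_space i y ^+ 2) _ :=
    is_deriveX 2 (is_derive_rescaled_space i z v).
  by apply: is_derive_eq h _; rewrite /= expr1.
have h : is_derive z v paraboloid _ := is_deriveB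
  (is_deriveB (is_derive_cst (1 : R) z v) (is_derive_sum_fun dsq))
  (is_deriveX 2 (is_derive_rescaled_time z v)).
by apply: is_derive_eq h _; rewrite sub0r /= expr1.
Qed.

Lemma is_derive_well z v d : is_derive z v paraboloid d ->
  is_derive z v well (well z * log_slope z * d).
Proof.
move=> du; have df : is_derive z v (fun y => - M * flat 0 (paraboloid y))
    (log_slope z * d).
  have h : is_derive z v (fun y => - M * flat 0 (paraboloid y)) _ :=
    is_deriveZ (- M) (is_derive_comp_dir (is_derive_flat 0 _) du).
  by apply: is_derive_eq h _; rewrite mul0r subr0 [LHS]mulrA.
rewrite -mulrA; exact: (is_derive_comp_dir (is_derive_expR _) df).
Qed.

Lemma is_derive_log_slope z v d : is_derive z v paraboloid d ->
  is_derive z v log_slope (log_curvature z * d).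
Proof.
move=> du; have h : is_derive z v log_slope _ :=
  is_deriveZ (- M) (is_derive_comp_dir (is_derive_flat 2 _) du).
by apply: is_derive_eq h _; rewrite [LHS]mulrA.
Qed.

Lemma is_derive_paraboloid_space z i :
  is_derive z (space_dir R i) paraboloid (- 2 * delta^-1 * rescaled_space i z).
Proof.
apply: is_derive_eq (is_derive_paraboloid _ _) _.
rewrite /space_dir /= !mulr0 subr0 (bigD1 i)//= big1 ?addr0; last first.
  by move=> j ji; rewrite /basis_vec mxE eqxx (negbTE ji) !mulr0.
by rewrite /basis_vec mxE !eqxx /=; ring.
Qed.

Lemma is_derive_paraboloid_time z :
  is_derive z (time_dir R n tt) paraboloid (- 2 * delta^-1 ^+ 2 * rescaled_time z).
Proof.
apply: is_derive_eq (is_derive_paraboloid _ _) _.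
rewrite /time_dir /= big1 ?mulr1; first by ring.
by move=> i _; rewrite mxE !mulr0.
Qed.

Lemma derive1_well x t :
  derive1 (fun s => well (x, s)) t =
  well (x, t) * log_slope (x, t) * (- 2 * delta^-1 ^+ 2 * rescaled_time (x, t)).
Proof.
rewrite derive1E; apply: derive_val; apply: is_derive_time_slice.
apply: is_derive_well; exact: is_derive_paraboloid_time.
Qed.

Lemma laplacian_well x t :
  laplacian (fun y => well (y, t)) x =
  well (x, t) * delta^-1 ^+ 2 *
    (4 * (log_curvature (x, t) + log_slope (x, t) ^+ 2) *
       \sum_(i < n) rescaled_space i (x, t) ^+ 2
     - 2 * n%:R * log_slope (x, t)).
Proof.
rewrite /laplacian.
have D1 i : 'D_(basis_vec R i) (fun y => well (y, t)) =
    fun y => well (y, t) * log_slope (y, t) *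
      (- 2 * delta^-1 * rescaled_space i (y, t)).
  apply/funext => y; apply: derive_val; apply: is_derive_space_slice.
  apply: is_derive_well; exact: is_derive_paraboloid_space.
have D2 i : 'D_(basis_vec R i) ('D_(basis_vec R i) (fun y => well (y, t))) x =
    well (x, t) * delta^-1 ^+ 2 *
      (4 * (log_curvature (x, t) + log_slope (x, t) ^+ 2) *
         rescaled_space i (x, t) ^+ 2 - 2 * log_slope (x, t)).
  rewrite D1; apply: derive_val.
  pose z := (x, t); pose v := space_dir R i.
  apply: (is_derive_space_slice
    (fun z => well z * log_slope z * (- 2 * delta^-1 * rescaled_space i z))).
  have du := is_derive_paraboloid_space z i.
  have h : is_derive z v (fun z => well z * log_slope z *
      (- 2 * delta^-1 * rescaled_space i z)) _ :=
    is_deriveM (is_deriveM (is_derive_well _ _ _ du)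
        (is_derive_log_slope _ _ _ du))
      (is_deriveZ (- 2 * delta^-1) (is_derive_rescaled_space i z v)).
  apply: is_derive_eq h _.
  rewrite /v /z /GRing.scale /= !fctE /space_dir /= /basis_vec mxE !eqxx /=.
  rewrite /GRing.scale /=; ring.
under eq_bigr do rewrite D2.
rewrite -mulr_sumr big_split /= -mulr_sumr sumr_const card_ord -mulr_natl.
by congr (_ * (_ + _)); ring.
Qed.

Lemma well_heat_equation x t :
  derive1 (fun s => well (x, s)) t =
  laplacian (fun y => well (y, t)) x + well_potential (x, t) * well (x, t).
Proof. by rewrite derive1_well laplacian_well /well_potential; ring. Qed.

Section smoothness.
Context (I : Type) (dir : I -> 'rV[R]_n * R).

Lemma Cinf_rescaled_space i : Cinf dir setT setT (rescaled_space i).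
Proof.
move=> k; apply: CkM; first exact: Ck_cst.
by apply: CkD; [exact: Ck_space_coord|exact: Ck_cst].
Qed.

Lemma Cinf_rescaled_time : Cinf dir setT setT rescaled_time.
Proof.
move=> k; apply: CkM; first exact: Ck_cst.
by apply: CkD; [exact: Ck_time_coord|exact: Ck_cst].
Qed.

Lemma Cinf_sum_rescaled_space :
  Cinf dir setT setT (fun z => \sum_(i < n) rescaled_space i z ^+ 2).
Proof.
by move=> k; apply: Ck_sum => i; apply: CkM; exact: Cinf_rescaled_space.
Qed.

Lemma Cinf_paraboloid : Cinf dir setT setT paraboloid.
Proof.
move=> k; apply: CkD; last by apply: CkN; apply: CkM; exact: Cinf_rescaled_time.
apply: CkD; first exact: Ck_cst.
by apply: CkN; exact: Cinf_sum_rescaled_space.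
Qed.

Lemma Cinf_flat_paraboloid m :
  Cinf dir setT setT (fun z => flat m (paraboloid z)).
Proof.
by move=> k; apply: Ck_comp; [exact: Cinf_flat|exact: Cinf_paraboloid].
Qed.

Lemma Cinf_well : Cinf dir setT setT well.
Proof.
move=> k; apply: Ck_comp; first exact: Cinf_expR.
by apply: CkM; [exact: Ck_cst|exact: Cinf_flat_paraboloid].
Qed.

Lemma Cinf_log_slope : Cinf dir setT setT log_slope.
Proof.
by move=> k; apply: CkM; [exact: Ck_cst|exact: Cinf_flat_paraboloid].
Qed.

Lemma Cinf_well_potential : Cinf dir setT setT well_potential.
Proof.
move=> k; apply: CkM; first exact: Ck_cst.
apply: CkD.
  apply: CkM; first by apply: CkM; [exact: Ck_cst|exact: Cinf_log_slope].
  by apply: CkD; [exact: Ck_cst|apply: CkN; exact: Cinf_rescaled_time].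
apply: CkN; apply: CkM; last exact: Cinf_sum_rescaled_space.
apply: CkM; first exact: Ck_cst.
apply: CkD; last by apply: CkM; exact: Cinf_log_slope.
apply: CkM; first exact: Ck_cst.
apply: CkD; first exact: Cinf_flat_paraboloid.
by apply: CkN; apply: CkM; [exact: Ck_cst|exact: Cinf_flat_paraboloid].
Qed.

End smoothness.

Lemma paraboloid_center : paraboloid (x0, t0) = 1.
Proof.
rewrite /paraboloid /rescaled_time /= subrr mulr0 expr0n subr0.
rewrite big1 ?subr0// => i _.
by rewrite /rescaled_space /= subrr mulr0 expr0n.
Qed.

Lemma rescaled_le1 z : 0 < paraboloid z ->
  (\sum_(i < n) rescaled_space i z ^+ 2 <= 1) /\ `|rescaled_time z| <= 1.
Proof.
rewrite /paraboloid => u0.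
have s0 : 0 <= \sum_(i < n) rescaled_space i z ^+ 2.
  by apply: sumr_ge0 => i _; exact: sqr_ge0.
have t2 := sqr_ge0 (rescaled_time z).
split; first by lra.
by rewrite -(expr_le1 (n:=2))// real_normK ?num_real//; lra.
Qed.

Lemma well_potential_eq0 z : paraboloid z <= 0 -> well_potential z = 0.
Proof.
move=> u0; rewrite /well_potential /log_slope /log_curvature !flat_le0//; ring.
Qed.

Lemma well_eq1 z : paraboloid z <= 0 -> well z = 1.
Proof. by move=> u0; rewrite /well flat_le0// mulr0 expR0. Qed.

Lemma paraboloid_gt0_box z : 0 < delta -> 0 < paraboloid z ->
  cube x0 delta z.1 /\ `|z.2 - t0| <= delta ^+ 2.
Proof.
move=> d0 /rescaled_le1[s1 t1]; split.
  move=> i.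
  have : `|rescaled_space i z| <= 1.
    rewrite -(expr_le1 (n:=2))// real_normK ?num_real//.
    apply: le_trans s1; rewrite (bigD1 i)//= lerDl.
    by apply: sumr_ge0 => j _; exact: sqr_ge0.
  rewrite /rescaled_space normrM gtr0_norm ?invr_gt0// mulrC.
  rewrite ler_pdivrMr// mul1r.
  by rewrite ler_norml; lra.
move: t1; rewrite /rescaled_time normrM exprVn gtr0_norm ?invr_gt0 ?exprn_gt0//.
by rewrite mulrC ler_pdivrMr ?exprn_gt0// mul1r.
Qed.

(** A bound for the potential at scale [delta] = 1: the first term bounds
    the contribution of [log_slope], with |log_slope| <= 2! M, and the second that
    of the other term, with |log_curvature| <= (4! + 2 * 3!) M = 36 M. *)
Definition potential_bound : R :=
  4 * M * (n%:R + 1) + 4 * (36 * M + 4 * M ^+ 2).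

Lemma norm_well_potential_le z : 0 < delta -> 0 <= M ->
  `|well_potential z| <= potential_bound * delta^-1 ^+ 2.
Proof.
move=> d0 M0; have d2 : 0 <= delta^-1 ^+ 2 by exact: sqr_ge0.
have n0 : 0 <= n%:R :> R by exact: ler0n.
have [/well_potential_eq0 ->|u0] := leP (paraboloid z) 0.
  rewrite normr0 mulr_ge0// /potential_bound; have := sqr_ge0 M; nra.
have [s1 t1] := rescaled_le1 z u0.
have s0 : 0 <= \sum_(i < n) rescaled_space i z ^+ 2.
  by apply: sumr_ge0 => i _; exact: sqr_ge0.
rewrite /well_potential normrM ger0_norm// mulrC ler_wpM2r//.
have f2 := flat_ge0 2 (paraboloid z); have f2' := flat_le_fact 2 (paraboloid z).
have f3 := flat_ge0 3 (paraboloid z); have f3' := flat_le_fact 3 (paraboloid z).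
have f4 := flat_ge0 4 (paraboloid z); have f4' := flat_le_fact 4 (paraboloid z).
have slope : `|log_slope z| <= 2 * M.
  rewrite /log_slope mulNr normrN ger0_norm ?mulr_ge0// mulrC ler_wpM2r//.
have curv : `|log_curvature z| <= 36 * M.
  rewrite /log_curvature mulNr normrN normrM ger0_norm// mulrC ler_wpM2r//.
  have [g3 g4] : 3`!%:R = 6 :> R /\ 4`!%:R = 24 :> R by [].
  by rewrite ler_norml; rewrite g3 in f3'; rewrite g4 in f4'; lra.
have slope2 : `|log_slope z ^+ 2| <= 4 * M ^+ 2.
  rewrite normrX (_ : 4 * M ^+ 2 = (2 * M) ^+ 2); last by ring.
  by rewrite lerXn2r ?nnegrE ?mulr_ge0.
move: slope curv slope2; move: (log_slope z) (log_curvature z).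
move=> sl lc slope curv slope2.
rewrite /potential_bound; apply: le_trans (ler_normB _ _) _; apply: lerD.
  rewrite !normrM (ger0_norm (ler0n _ 2)).
  rewrite (_ : 4 * M * _ = (2 * (2 * M)) * (n%:R + 1)); last by ring.
  apply: ler_pM; rewrite ?mulr_ge0 ?normr_ge0 ?ler_wpM2l//.
  by apply: le_trans (ler_normB _ _) _; rewrite ger0_norm//; lra.
rewrite !normrM (ger0_norm (ler0n _ 4)) (ger0_norm s0).
rewrite -[leRHS]mulr1; apply: ler_pM; rewrite ?mulr_ge0 ?normr_ge0 ?ler_wpM2l//.
by apply: le_trans (ler_normD _ _) _; exact: lerD.
Qed.

(** Parabolic scaling: the potential is of size [delta] ^ -2 on a box of volume
    [delta] ^ n times a time interval of length [delta] ^ 2. *)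
Lemma mixed_norm_well_potential (O : set 'rV[R]_n) (p q T : R) :
  0 < delta -> 0 <= M -> 0 < p -> 0 < q ->
  (\int[lebesgue_measure]_(t in `]0%R, T[)
     (Lp_norm O p (fun x => well_potential (x, t)) `^ q)
   <= (potential_bound `^ q * 2 `^ (n%:R / p * q) * 2 *
       delta `^ (n%:R / p * q - 2 * q + 2))%:E)%E.
Proof.
move=> d0 M0 p0 q0.
have B0 : 0 <= potential_bound.
  by rewrite /potential_bound; have := sqr_ge0 M; have := ler0n R n; nra.
have d2 : 0 <= delta^-1 ^+ 2 by exact: sqr_ge0.
apply: le_trans (@mixed_norm_le_cst_on_box _ _ O p q
  (potential_bound * delta^-1 ^+ 2) delta (delta ^+ 2) T t0 x0 well_potential
  p0 q0 _ (ltW d0) _ _ _) _.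
- exact: mulr_ge0.
- exact: sqr_ge0.
- by move=> x t; exact: norm_well_potential_le.
- move=> x t.
  have [/well_potential_eq0 ->|/(paraboloid_gt0_box _ d0)//] :=
    leP (paraboloid (x, t)) 0.
  by rewrite eqxx.
rewrite lee_fin.
suff -> : (potential_bound * delta^-1 ^+ 2 * ((2 * delta) ^+ n) `^ p^-1) `^ q *
    (2 * delta ^+ 2) = potential_bound `^ q * 2 `^ (n%:R / p * q) * 2 *
    delta `^ (n%:R / p * q - 2 * q + 2) by [].
have dn0 : delta != 0 by exact: lt0r_neq0.
rewrite (_ : delta `^ (n%:R / p * q - 2 * q + 2) =
  delta `^ (n%:R / p * q) * delta `^ (- (2 * q)) * delta `^ 2); last first.
  by rewrite -!powRD ?dn0 ?implybT.
rewrite -!powR_mulrn ?mulr_ge0 ?invr_ge0 ?(ltW d0)//.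
rewrite -powRrM -powR_inv1 ?(ltW d0)// -powRrM.
rewrite !powRM ?mulr_ge0 ?powR_ge0 ?(ltW d0)// -!powRrM.
rewrite (_ : -1 * 2 * q = - (2 * q)); last by ring.
ring.
Qed.

(** Outside the closed cube the paraboloid is strictly negative, so it stays so
    nearby, and the well is locally constant. *)
Lemma well_near_outside (x nu : 'rV[R]_n) (t : R) : 0 < delta ->
  ~ cube x0 delta x ->
  \forall h \near (0 : R), well (x - h *: nu, t) = 1.
Proof.
move=> d0 nx.
have u0 : paraboloid (x, t) < 0.
  move/existsNP: nx => [i /negP nx].
  have yi : 1 < `|rescaled_space i (x, t)|.
    rewrite /rescaled_space normrM gtr0_norm ?invr_gt0// mulrC.
    rewrite ltr_pdivlMr// mul1r.
    by rewrite ltNge ler_norml; move: nx; lra.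
  have yi2 : 1 < rescaled_space i (x, t) ^+ 2.
    by rewrite -real_normK ?num_real// -[ltLHS](expr1n _ 2) ltrXn2r.
  rewrite /paraboloid (bigD1 i)//=.
  have := sqr_ge0 (rescaled_time (x, t)).
  have : 0 <= \sum_(j < n | j != i) rescaled_space j (x, t) ^+ 2.
    by apply: sumr_ge0 => j _; exact: sqr_ge0.
  lra.
have cu : {for 0, continuous (fun h : R => paraboloid (x - h *: nu, t))}.
  apply: (@continuous_comp _ _ _ (fun h : R => (x - h *: nu, t)) paraboloid).
    have cx : (x - h *: nu) @[h --> (0 : R)] --> (x - 0 *: nu).
      by apply: cvgB; [exact: cvg_cst|apply: cvgZr_tmp; exact: cvg_id].
    exact: (cvg_pair cx (cvg_cst t)).
  have cp : continuous paraboloid.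
    apply/continuous_subspace_setT.
    exact: (Cinf_paraboloid _ (@spacetime_dir R n) 0).1.
  exact: cp.
have : \forall h \near (0 : R), paraboloid (x - h *: nu, t) < 0.
  by apply: (cvgr_lt _ cu); rewrite scale0r subr0.
by apply: filterS => h hu; rewrite well_eq1// ltW.
Qed.

End profile.

(** * Choice of the scale *)

Lemma exists_small_scale (R : realType) (sigma K r tau : R) :
  0 < sigma -> 0 < r -> 0 < tau ->
  exists delta : R, [/\ 0 < delta, delta <= r, delta ^+ 2 <= tau &
    K * delta `^ sigma <= 1].
Proof.
move=> s0 r0 tau0.
near (0 : R)^'+ => d; exists d; split.
- by near: d; exact: nbhs_right_gt.
- by near: d; exact: nbhs_right_le.
- have d0 : 0 < d by near: d; exact: nbhs_right_gt.
  have d1 : d <= Num.min 1 tau.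
    by near: d; apply: nbhs_right_le; rewrite lt_min ltr01.
  move: d1; rewrite le_min => /andP[d1 dt].
  by apply: le_trans dt; rewrite expr2 ler_piMl// ltW.
- near: d.
  have : (K * d `^ sigma) @[d --> (0 : R)^'+] --> K * 0.
    by apply: cvgM; [exact: cvg_cst|exact: powR_cvg0].
  rewrite mulr0 => /cvgr_le; apply; exact: ltr01.
Unshelve. all: by end_near.
Qed.

Theorem proposition1p2 (R : realType) (n : nat) (Omega : set 'rV[R]_n)
    (p q T : R) (x0 : 'rV[R]_n) :
  (1 <= n)%N ->
  smooth_bounded_domain Omega ->
  1 <= p -> 1 <= q ->
  1 < q^-1 + n%:R / (2 * p) ->
  0 < T ->
  Omega x0 ->
  exists (L : R) (b : nat -> 'rV[R]_n * R -> R) (V0 : 'rV[R]_n -> R),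
    [/\ 0 < L,
        (forall k, Cinf (@spacetime_dir R n) (Omega `*` `]0, T[)
                        (closure Omega `*` `[0, T]) (b k)),
        Cinf (@basis_vec R n) Omega (closure Omega) V0 &
        (forall x, closure Omega x -> 0 < V0 x)] /\
    (forall k,
       (\int[lebesgue_measure]_(t in `]0%R, T[)
          (Lp_norm Omega p (fun x => b k (x, t)) `^ q) <= L%:E)%E) /\
    (forall x, Omega x -> 0 <= V0 x <= L) /\
    ((L^-1)%:E <= \int[lebesgueRn R n]_(x in Omega) (V0 x)%:E)%E /\
    exists V : nat -> 'rV[R]_n * R -> R,
      (forall k,
         [/\ {within closure Omega `*` `[0, T], continuous (V k)},
             C21 (Omega `*` `]0, T[) (closure Omega `*` `]0, T[) (V k),
             (forall x t, Omega x -> 0 < t < T ->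
                derive1 (fun s => V k (x, s)) t =
                laplacian (fun y => V k (y, t)) x + b k (x, t) * V k (x, t)),
             (forall x t nu, boundary Omega x -> 0 < t < T ->
                outward_unit_normal Omega x nu ->
                normal_derivative_is (fun y => V k (y, t)) x nu 0) &
             (forall x, Omega x -> V k (x, 0) = V0 x)]) /\
      ereal_inf [set (V k (x0, t))%:E | t in `]0, T[] @[k --> \oo] --> 0%E.
Proof.
move=> n1 [oO _ _ _] p1 q1 pq T0 Ox0.
have p0 : 0 < p by exact: lt_le_trans ltr01 p1.
have q0 : 0 < q by exact: lt_le_trans ltr01 q1.
have [r r0 rO] : exists2 r : R, 0 < r & cube x0 r `<=` Omega.
  have /nbhs_ballP[r /= r0 rO] : nbhs x0 Omega by exact: open_nbhs_nbhs.
  exists (r / 2); first by rewrite divr_gt0.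
  move=> x xr; apply: rO; split=> // i j; rewrite ord1.
  rewrite /ball /= ltr_norml; have := xr j; lra.
have sigma0 : 0 < n%:R / p * q - 2 * q + 2.
  have : (q * 2) * 1 < (q * 2) * (q^-1 + n%:R / (2 * p)).
    by rewrite ltr_pM2l// mulr_gt0.
  rewrite (_ : q * 2 * (q^-1 + _) = 2 + n%:R / p * q); last first.
    by field; rewrite !lt0r_neq0.
  lra.
(* The well is centred at time T / 2; with delta ^ 2 <= T / 4 it is not yet felt
   at time 0, so that the initial value is 1 for every k. *)
have /choice[delta deltaP] : forall k : nat, exists d : R,
    [/\ 0 < d, d <= r, d ^+ 2 <= T / 4 &
    potential_bound R n k%:R `^ q * 2 `^ (n%:R / p * q) * 2 *
      d `^ (n%:R / p * q - 2 * q + 2) <= 1].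
  by move=> k; apply: exists_small_scale => //; rewrite divr_gt0.
pose V k := well R n x0 (T / 2) (delta k) k%:R.
pose b k := well_potential R n x0 (T / 2) (delta k) k%:R.
pose m := (2 * r) ^+ n.
have m0 : 0 < m by rewrite exprn_gt0// mulr_gt0.
(* m is the volume of a cube inside Omega; the other 1 bounds both V0 and the
   mixed norms. *)
exists (1 + m^-1), b, (fun=> 1).
have mV0 : 0 < m^-1 by rewrite invr_gt0.
split; [split|split; [|split; [|split]]].
- by rewrite addr_gt0.
- by move=> k j; (apply: Ck_sub; last exact: Cinf_well_potential);
    exact: subsetT.
- by move=> k; exact: Ck_cst.
- by [].
- move=> k; have [d0 _ _ small] := deltaP k.
  apply: le_trans (mixed_norm_well_potential _ _ x0 (T / 2) _ k%:R Omega
    _ _ T d0 (ler0n _ _) p0 q0) _.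
  by rewrite lee_fin; apply: le_trans small _; rewrite lerDl ltW.
- by move=> x _; rewrite ler01 lerDl ltW.
- apply: (@le_trans _ _ (lebesgueRn R n (cube x0 r))); last first.
    by apply: measure_le_integral_cst1 => //; exact: measurable_cube.
  rewrite lebesgueRn_cube ?(ltW r0)// lee_fin.
  by rewrite -[leRHS]invrK lef_pV2 ?posrE ?addr_gt0// lerDr.
exists V; split.
  move=> k; have [d0 dr dT _] := deltaP k.
  have CV I dir := Cinf_well R n x0 (T / 2) (delta k) k%:R I dir.
  split.
  - apply: continuous_subspaceT.
    apply/continuous_subspace_setT; exact: (CV _ (@spacetime_dir R n) 0).1.
  - by split; (apply: Ck_sub; last exact: CV); exact: subsetT.
  - by move=> x t _ _; exact: well_heat_equation.
  - move=> x t nu [_ nx] _ _.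
    have {}nx : ~ cube x0 (delta k) x.
      move=> cx; apply: nx.
      rewrite (_ : interior Omega = Omega); last exact/interior_id.
      by apply: rO => i; have := cx i; lra.
    have V1 : \forall h \near (0 : R), V k (x - h *: nu, t) = 1.
      exact: well_near_outside.
    have Vx : V k (x, t) = 1.
      by have := nbhs_singleton V1; rewrite scale0r subr0.
    apply: (@cvg_trans _ (cst 0 @ (0 : R)^'+)); last exact: cvg_cst.
    apply: near_eq_cvg.
    apply: cvg_within; apply: filterS V1 => h Vh.
    by rewrite /= Vx Vh subrr mul0r.
  - move=> x _; apply: well_eq1.
    rewrite leNgt; apply/negP => /(paraboloid_gt0_box _ _ _ _ _ _ d0)[_ /=].
    by rewrite sub0r normrN gtr0_norm ?divr_gt0//; lra.
have ET : 0 < T / 2 < T by lra.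
have c0 : 0 < flat 0 (1 : R) by rewrite /flat ltr01 mul1r expR_gt0.
apply: (@squeeze_cvge _ _ _ _ (cst 0%E) _
  (fun k => (expR (- k%:R * flat 0 (1 : R)))%:E)).
- near=> k; apply/andP; split.
    by apply: le_ereal_inf_tmp => _ [t _ <-]; rewrite lee_fin expR_ge0.
  apply: ereal_inf_lbound; exists (T / 2); first by rewrite /= in_itv.
  by rewrite /V /well paraboloid_center.
- exact: cvg_cst.
- apply: cvg_EFin; first by near=> k.
  rewrite (_ : _ \o _ = fun k : nat => expR (- flat 0 (1 : R)) ^+ k); last first.
    by apply/funext => k /=; rewrite -expRM_natl mulrN mulNr.
  apply: cvg_expr; rewrite ger0_norm ?expR_ge0// expR_lt1; lra.
Unshelve. all: by end_near.
Qed.
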